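(* Let $V$ be a finite-dimensional $U(\mathfrak{sl}_2)$-module, regarded as an $\Re$-module by pulling back via $\sharp$. Then (i) the $\Re$-module $V$ is completely reducible; and (ii) $A,B,C$ act on every irreducible $\Re$-submodule of $V$ as a Leonard triple.
   Context: All algebras are unital associative over $\mathbb C$, $[x,y]=xy-yx$, $\mathbf i=\sqrt{-1}$. $U(\mathfrak{sl}_2)$ is generated by $E,F,H$ with $[H,E]=2E$, $[H,F]=-2F$, $[E,F]=H$. $\Re$ is generated by $A,B,C,\Delta$ with $[A,B]=[B,C]=[C,A]=2\Delta$ and such that $[A,\Delta]+AC-BA$, $[B,\Delta]+BA-CB$, $[C,\Delta]+CB-AC$ are central. $\sharp:\Re\to U(\mathfrak{sl}_2)$ is the algebra homomorphism with $A\mapsto \frac{(E+F-2)(E+F+2)}{16}$, $B\mapsto\frac{(H-2)(H+2)}{16}$, $C\mapsto\frac{(\mathbf iE-\mathbf iF-2)(\mathbf iE-\mathbf iF+2)}{16}$, $\Delta\mapsto\frac{(H+2)F^2-(H-2)E^2}{64}$. A square matrix is irreducible tridiagonal if all nonzero entries lie on the diagonal, subdiagonal or superdiagonal and all sub- and superdiagonal entries are nonzero. An ordered triple $L,L^*,L^\varepsilon$ of linear operators on a finite-dimensional nonzero space $W$ is a Leonard triple if for each of the three operators there is a basis of $W$ in which that operator is diagonal and the other two are irreducible tridiagonal. *)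

(* Defs.v *)
From HB Require Import structures.
From mathcomp Require Import all_boot all_order all_algebra.
From mathcomp Require Import complex.
From mathcomp Require Import reals.
Set Implicit Arguments. Unset Strict Implicit. Unset Printing Implicit Defensive.
Import Order.TTheory GRing.Theory Num.Theory.
Local Open Scope ring_scope.


Section Defs.
Variables (R : realType).
Notation Cx := (R[i]).
Variable (V : vectType Cx).
Implicit Types (E F H L : 'End(V)).

Definition is_sl2_module E F H : Prop :=
  [/\ ((H \o E) - (E \o H))%VF = 2%:R *: E,
      ((H \o F) - (F \o H))%VF = - (2%:R *: F)
    & ((E \o F) - (F \o E))%VF = H].

Definition sharpA E F : 'End(V) :=
  (16%:R)^-1 *: ((E + F - 2%:R *: \1) \o (E + F + 2%:R *: \1))%VF.
Definition sharpB H : 'End(V) :=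
  (16%:R)^-1 *: ((H - 2%:R *: \1) \o (H + 2%:R *: \1))%VF.
Definition sharpC E F : 'End(V) :=
  (16%:R)^-1 *: (('i *: E - 'i *: F - 2%:R *: \1)
                   \o ('i *: E - 'i *: F + 2%:R *: \1))%VF.
Definition sharpDelta E F H : 'End(V) :=
  (64%:R)^-1 *: (((H + 2%:R *: \1) \o (F \o F)) - ((H - 2%:R *: \1) \o (E \o E)))%VF.

Definition sharp_gens E F H : seq 'End(V) :=
  [:: sharpA E F; sharpB H; sharpC E F; sharpDelta E F H].

(* a subspace invariant under all the given operators, i.e. a submodule for
   the algebra they generate *)
Definition submodule (gens : seq 'End(V)) (W : {vspace V}) : Prop :=
  forall L, L \in gens -> (L @: W <= W)%VS.

Definition irreducible_submodule (gens : seq 'End(V)) (W : {vspace V}) : Prop :=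
  [/\ submodule gens W, W != 0%VS &
      forall U : {vspace V}, submodule gens U -> (U <= W)%VS ->
        U = 0%VS \/ U = W].

Definition completely_reducible (gens : seq 'End(V)) : Prop :=
  exists Ws : seq {vspace V},
    [/\ forall W, W \in Ws -> irreducible_submodule gens W,
        directv (\sum_(W <- Ws) W) & (\sum_(W <- Ws) W)%VS = fullv].

(* matrix entry (i,j) of the operator L in the basis b : L b_j = sum_i M i j b_i *)
Definition mx_entry d (b : d.-tuple V) L (i j : 'I_d) : Cx :=
  coord b i (L (tnth b j)).

Definition is_diag_in d (b : d.-tuple V) L : Prop :=
  forall i j : 'I_d, i != j -> mx_entry b L i j = 0.

Definition is_irred_tridiag_in d (b : d.-tuple V) L : Prop :=
  forall i j : 'I_d,
    ((i.+1 < j)%N \/ (j.+1 < i)%N -> mx_entry b L i j = 0) /\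
    ((i.+1 == j) || (j.+1 == i) -> mx_entry b L i j != 0).

Definition LT_basis (W : {vspace V}) L1 L2 L3 : Prop :=
  exists b : (\dim W).-tuple V,
    [/\ basis_of W b, is_diag_in b L1, is_irred_tridiag_in b L2
      & is_irred_tridiag_in b L3].

Definition leonard_triple_on (W : {vspace V}) L Ls Le : Prop :=
  [/\ W != 0%VS, (L @: W <= W)%VS, (Ls @: W <= W)%VS & (Le @: W <= W)%VS] /\
  [/\ LT_basis W L Ls Le, LT_basis W Ls L Le & LT_basis W Le L Ls].

End Defs.

(* Main.v *)
(**
  The operators X = E + F, Y = H, Z = i(E - F) satisfy [X,Y] = 2iZ and its
  cyclic permutations, and A, B, C are (X^2-4)/16, (Y^2-4)/16, (Z^2-4)/16, while
  2 Delta = [A,B].  By this cyclic symmetry it suffices to diagonalise B.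

  On ker E one has E^k F^k = k! H(H-1)...(H-k+1); as F is nilpotent, H is
  diagonalisable on ker E with natural eigenvalues.  This forces im E and ker F
  to meet trivially, so V = ker E + im F by dimension count, and V is spanned
  by the vectors v_i = F^i v / i! with v of highest weight n.

  The operators A, B, C preserve the parity of i and commute with the reflection
  v_i <-> v_(n-i).  For n odd take the v_i, and for n even the
  v_i +- v_(n-i), with i of fixed parity: these are chains of B-eigenvectors with
  distinct eigenvalues on which A and C are irreducible tridiagonal.  Such a
  chain spans an irreducible submodule, so V is a direct sum of chain modules; an
  irreducible submodule W inherits a chain by projecting along a partial sum
  that is disjoint from W.
*)
Require Import Defs.
From HB Require Import structures.
From mathcomp Require Import all_boot all_order all_algebra.
From mathcomp Require Import complex.
From mathcomp Require Import reals.
From mathcomp Require Import ring zify.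
From mathcomp Require boolp.
Import GRing.Theory Num.Theory.
Local Open Scope ring_scope.
Import VectorInternalTheory.
Set Implicit Arguments. Unset Strict Implicit. Unset Printing Implicit Defensive.

Section LinearRewriting.
Variables (K : fieldType) (U V : vectType K).
Implicit Types (f : 'Hom(U, V)) (x y : U).

Lemma lfunD f x y : f (x + y) = f x + f y. Proof. exact: linearD. Qed.
Lemma lfunN f x : f (- x) = - f x. Proof. exact: linearN. Qed.
Lemma lfunZ f a x : f (a *: x) = a *: f x. Proof. exact: linearZ. Qed.
Lemma lfun0 f : f 0 = 0. Proof. exact: linear0. Qed.

Lemma v2rD x y : v2r (x + y) = v2r x + v2r y. Proof. exact: linearD. Qed.
Lemma v2rN x : v2r (- x) = - v2r x. Proof. exact: linearN. Qed.
Lemma v2rZ a x : v2r (a *: x) = a *: v2r x. Proof. exact: linearZ. Qed.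
Lemma v2r0 : v2r (0 : U) = 0. Proof. exact: linear0. Qed.

End LinearRewriting.

(* The generic [linearZ] would loop on [a *: (b *: x)], hence the specialised rules. *)
Definition lfun_linE := (lfunD, lfunN, lfunZ, lfun0).
Definition v2r_linE := (v2rD, v2rN, v2rZ, v2r0).

Ltac vlin := apply: v2r_inj; apply/rowP => ?; rewrite ?v2r_linE ?mxE.

Ltac vring := vlin; ring.

(** * Eigenvectors *)

Section Spectral.
Variables (K : fieldType) (V : vectType K).

Lemma eigen_components (T : V -> V) (U : {vspace V}) m (x : nat -> V) (l : nat -> K) :
  linear T -> {homo T : y / y \in U} ->
  (forall i, (i < m)%N -> T (x i) = l i *: x i) ->
  (forall i j, (i < j < m)%N -> l i != l j) ->
  \sum_(i < m) x i \in U -> forall i, (i < m)%N -> x i \in U.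
Proof.
move=> linT TU.
have T0 : T 0 = 0 by have := linT (-1) 0 0; rewrite scaler0 addr0 scaleN1r addNr.
have TD y z : T (y + z) = T y + T z by have := linT 1 y z; rewrite !scale1r.
have TZ a y : T (a *: y) = a *: T y by have := linT a y 0; rewrite T0 !addr0.
elim: m x => [|m IHm] x Tx injl; first by [].
rewrite big_ord_recr /= => Ux.
have sub i : (i < m)%N -> x i \in U.
  move=> im; have nz : l i - l m != 0 by rewrite subr_eq0 injl // im ltnSn.
  suff: (l i - l m) *: x i \in U by move/(memvZ (l i - l m)^-1); rewrite scalerK.
  apply: (IHm (fun i => (l i - l m) *: x i)) (im).
  - by move=> j jm; rewrite TZ Tx 1?ltnW // !scalerA mulrC.
  - by move=> j k /andP[jk km]; rewrite injl // jk ltnW.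
  suff -> : \sum_(i0 < m) (l i0 - l m) *: x i0
      = T (\sum_(i < m) x i + x m) - l m *: (\sum_(i < m) x i + x m).
    by rewrite memvB ?TU // memvZ.
  rewrite TD Tx // scalerDr opprD addrACA subrr addr0.
  rewrite (big_morph T TD T0) scaler_sumr -sumrB; apply: eq_bigr => j _.
  by rewrite Tx ?scalerBl // ltnS ltnW.
move=> i; rewrite ltnS leq_eqVlt => /predU1P[->|/sub//].
have /memvB/(_ Ux) : \sum_(j < m) x j \in U by apply: memv_suml => j _; apply: sub.
by rewrite opprD addNKr memvN.
Qed.

Lemma eigen_family_free (T : V -> V) m (x : nat -> V) (l : nat -> K) :
  linear T ->
  (forall i, (i < m)%N -> T (x i) = l i *: x i /\ x i != 0) ->
  (forall i j, (i < j < m)%N -> l i != l j) ->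
  free [tuple x i | i < m].
Proof.
move=> linT Tx injl; apply/freeP => k.
have TZ a y : T (a *: y) = a *: T y.
  have T0 : T 0 = 0 by have := linT (-1) 0 0; rewrite scaler0 addr0 scaleN1r addNr.
  by have := linT a y 0; rewrite T0 !addr0.
pose kk i := if insub i is Some j then k j else 0.
have kE (i : 'I_m) : kk i = k i by rewrite /kk valK.
move=> s0 i; have [_ nz] := Tx i (ltn_ord i).
have /(_ i (ltn_ord i)): forall i, (i < m)%N -> kk i *: x i \in 0%VS.
  apply: (eigen_components (T := T) (l := l)) => //.
  - by move=> y; rewrite !memv0 => /eqP->; rewrite -(scale0r 0) TZ !scale0r.
  - by move=> j jm; rewrite TZ; have [-> _] := Tx j jm; rewrite !scalerA mulrC.
  rewrite memv0 -[X in _ == X]s0; apply/eqP; apply: eq_bigr => j _.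
  by rewrite kE -tnth_nth tnth_mktuple.
by rewrite memv0 scaler_eq0 (negPf nz) orbF kE => /eqP.
Qed.

End Spectral.

(** * Finite-dimensional sl_2-modules *)

Section Sl2.
Variables (K : numFieldType) (V : vectType K).
Implicit Types E F H : 'End(V).

Definition sl2_rel E F H : Prop :=
  [/\ forall x, H (E x) = E (H x) + 2 *: E x,
      forall x, H (F x) = F (H x) - 2 *: F x
    & forall x, E (F x) = F (E x) + H x].

Lemma sl2_rel_swap E F H : sl2_rel E F H -> sl2_rel F E (- H).
Proof.
case=> HE HF EF; split=> x; rewrite !opp_lfunE ?HE ?HF ?EF ?linearN /= ?opprD ?opprK //.
by rewrite addrK.
Qed.

Lemma weight_iterF E F H : sl2_rel E F H -> forall i x,
  H (iter i F x) = iter i F (H x) - (2 * i%:R) *: iter i F x.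
Proof.
case=> _ HF _; elim=> [|i IHi] x /=; first by rewrite mulr0 scale0r subr0.
rewrite HF IHi linearB linearZ /= -natr1; vring.
Qed.

Lemma lfun_iterP (F : 'End(V)) i a x y : iter i F (a *: x + y) = a *: iter i F x + iter i F y.
Proof. by elim: i => //= i ->; rewrite linearP. Qed.

Lemma lfun_iterD (F : 'End(V)) i x y : iter i F (x + y) = iter i F x + iter i F y.
Proof. by have := lfun_iterP F i 1 x y; rewrite !scale1r. Qed.

Lemma lfun_iter0 (F : 'End(V)) i : iter i F 0 = 0.
Proof. by elim: i => //= i ->; rewrite linear0. Qed.

Lemma lfun_iterZ (F : 'End(V)) i a x : iter i F (a *: x) = a *: iter i F x.
Proof. by have := lfun_iterP F i a x 0; rewrite lfun_iter0 !addr0. Qed.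

Lemma E_iterF E F H : sl2_rel E F H -> forall i x,
  E (iter i.+1 F x) = iter i.+1 F (E x) + i.+1%:R *: iter i F (H x - i%:R *: x).
Proof.
move=> rel; have [_ HF EF] := rel; elim=> [|i IHi] x.
  by rewrite /= EF scale0r subr0 scale1r.
rewrite iterS EF IHi linearD linearZ /= (weight_iterF rel i.+1) /=.
rewrite -!scaleNr !(addrC (H x)) !lfun_iterP !linearP /= -!natr1; vring.
Qed.

Lemma iterE_nilpotent E F H : sl2_rel E F H -> exists N, forall x, iter N E x = 0.
Proof.
case=> HE _ _.
pose X k : 'End(V) := iter k (fun f => E \o f)%VF \1%VF.
have XE k x : X k x = iter k E x.
  elim: k x => [|k IHk] x; first by rewrite id_lfunE.
  by rewrite /= comp_lfunE IHk.
have [/existsP[k /eqP Xk]|nz] := boolP [exists k : 'I_(dim 'End(V)).+1, X k == 0].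
  by exists k => x; rewrite -XE Xk zero_lfunE.
have := @eigen_family_free K 'End(V) (fun f => (H \o f) - (f \o H))%VF
  (dim 'End(V)).+1 X (fun k => 2 * k%:R).
move=> Xfree; suff: free [tuple X i | i < (dim 'End(V)).+1].
  rewrite /free size_tuple => /eqP dimE.
  have := dimvS (subvf <<[tuple X i | i < (dim 'End(V)).+1]>>).
  rewrite dimE dimvf. by rewrite ltnn.
apply: Xfree.
- move=> a f g; apply/lfunP => x.
  rewrite !(add_lfunE, opp_lfunE, scale_lfunE, comp_lfunE) linearP /=; vring.
- move=> k kd; split; last first.
    by move: nz; rewrite negb_exists => /forallP/(_ (Ordinal kd)).
  apply/lfunP => x; rewrite !(add_lfunE, opp_lfunE, scale_lfunE, comp_lfunE) !XE.
  elim: k x {kd} => [|k IHk] x /=; first by rewrite subrr mulr0 scale0r.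
  rewrite HE; have := IHk x => /eqP; rewrite subr_eq => /eqP->.
  rewrite linearD linearZ /= -natr1; vring.
- move=> i j /andP[ij _]; rewrite -subr_eq0 -mulrBr mulf_neq0 ?pnatr_eq0 //.
  by rewrite subr_eq0 eqr_nat neq_ltn ij.
Qed.

Fixpoint fall_fact_op H k (x : V) : V :=
  if k is k'.+1 then fall_fact_op H k' (H x - k'%:R *: x) else x.

Lemma iterE_iterF E F H : sl2_rel E F H -> forall k x, E x = 0 ->
  iter k E (iter k F x) = k`!%:R *: fall_fact_op H k x.
Proof.
move=> rel; have [HE _ _] := rel; elim=> [|k IHk] x Ex; first by rewrite scale1r.
rewrite iterSr (E_iterF rel) Ex lfun_iter0 add0r lfun_iterZ IHk ?scalerA -?natrM //.
by rewrite linearB linearZ /= Ex scaler0 subr0; have := HE x;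
  rewrite Ex linear0 scaler0 addr0.
Qed.

Lemma fall_fact_op_ker E F H : sl2_rel E F H ->
  exists N, forall x, E x = 0 -> fall_fact_op H N x = 0.
Proof.
move=> rel; have [N nilF] := iterE_nilpotent (sl2_rel_swap rel).
exists N => x Ex; have := iterE_iterF rel N Ex.
rewrite nilF lfun_iter0 => /eqP; rewrite eq_sym scaler_eq0 pnatr_eq0.
by rewrite -leqn0 leqNgt fact_gt0 => /eqP.
Qed.

Lemma fall_fact_op_eigen H l x k : H x = l *: x ->
  fall_fact_op H k x = (\prod_(j < k) (l - j%:R)) *: x.
Proof.
move=> Hx; suff gen c : fall_fact_op H k (c *: x) = (c * \prod_(j < k) (l - j%:R)) *: x.
  by rewrite -[in LHS](scale1r x) gen mul1r.
elim: k c => [|k IHk] c; first by rewrite big_ord0 mulr1.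
rewrite /= linearZ /= Hx !scalerA -scalerBl IHk big_ord_recr /=; congr (_ *: _); ring.
Qed.

Lemma fall_fact_op_split H (S : {vspace V}) : {homo H : x / x \in S} ->
  forall N x, x \in S -> fall_fact_op H N x = 0 ->
  exists y : nat -> V, (forall j, y j \in S /\ H (y j) = j%:R *: y j) /\
    x = \sum_(j < N) y j.
Proof.
move=> HS; elim=> [|N IHN] x Sx /= hx.
  exists (fun=> 0); split=> [j|]; first by rewrite mem0v linear0 scaler0.
  by rewrite big_ord0.
have [|y [yP yE]] := IHN _ _ hx; first by rewrite memvB ?HS ?memvZ.
pose z j := (j%:R - N%:R : K)^-1 *: y j.
have zP j : z j \in S /\ H (z j) = j%:R *: z j.
  have [Sy Hy] := yP j; split; first exact: memvZ.
  by rewrite linearZ /= Hy !scalerA mulrC.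
have Hz : H (\sum_(j < N) z j) - N%:R *: (\sum_(j < N) z j) = \sum_(j < N) y j.
  rewrite linear_sum scaler_sumr -sumrB; apply: eq_bigr => j _ /=.
  rewrite (zP j).2 -scalerBl scalerA mulfV ?scale1r // subr_eq0 eqr_nat neq_ltn.
  by rewrite ltn_ord.
exists (fun j => if (j == N)%N then x - \sum_(j < N) z j else z j); split=> [j|].
  case: eqP => [->|_ //]; split.
    by rewrite memvB // memv_suml // => i _; have [] := zP i.
  have /eqP : H x - N%:R *: x = \sum_(j < N) y j by [].
  rewrite -Hz subr_eq linearB => /eqP /= ->; vring.
rewrite big_ord_recr /= eqxx [RHS]addrC -[LHS](subrK (\sum_(j < N) z j)).
by congr (_ + _); apply: eq_bigr => j _; rewrite ltn_eqF.
Qed.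

Lemma ker_weight_split E F H (S : {vspace V}) : sl2_rel E F H ->
  (S <= lker E)%VS -> {homo H : x / x \in S} -> forall x, x \in S ->
  exists N (y : nat -> V), (forall j, y j \in S /\ H (y j) = j%:R *: y j) /\
    x = \sum_(j < N) y j.
Proof.
move=> rel SE HS x Sx; have [N kerN] := fall_fact_op_ker rel.
exists N; apply: fall_fact_op_split => //; apply: kerN.
by apply/eqP; rewrite -memv_ker (subvP SE).
Qed.

Lemma ker_negative_weight E F H : sl2_rel E F H -> forall x n,
  E x = 0 -> H x = - n.+1%:R *: x -> x = 0.
Proof.
move=> rel x n Ex Hx; have [N /(_ x Ex)] := fall_fact_op_ker rel.
rewrite (fall_fact_op_eigen _ Hx) => /eqP; rewrite scaler_eq0 => /orP[|/eqP//].
rewrite prodf_seq_eq0 => /hasP[j _ /=].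
by rewrite -opprD oppr_eq0 -natrD pnatr_eq0 addSn.
Qed.

Lemma ker_H_stable E F H : sl2_rel E F H -> {homo H : x / x \in lker E}.
Proof.
case=> HE _ _ x; rewrite !memv_ker => /eqP Ex; have := HE x.
by rewrite Ex linear0 scaler0 addr0 => <-.
Qed.

Lemma limgE_kerF E F H : sl2_rel E F H -> (limg E :&: lker F = 0)%VS.
Proof.
move=> rel; have [HE HF EF] := rel; have rel' := sl2_rel_swap rel.
have [N nilF] := iterE_nilpotent rel'.
apply/eqP; rewrite -subv0; apply/subvP => x0 x0S.
have stab : {homo (- H) : x / x \in (limg E :&: lker F)%VS}.
  move=> x; rewrite !memv_cap => /andP[/memv_imgP[y _ ->] Fx].
  rewrite (ker_H_stable rel' Fx) andbT opp_lfunE HE memvN.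
  by rewrite -linearZ -linearD memv_img ?memvf.
have [M [y [yP ->]]] := ker_weight_split rel' (capvSr _ _) stab x0S.
suff wt0 u n : u \in (limg E :&: lker F)%VS -> (- H : 'End(V)) u = n%:R *: u -> u \in 0%VS.
  by apply: memv_suml => j _; have [yS Hy] := yP j; apply: wt0 yS Hy.
rewrite memv_cap memv_ker => /andP[/memv_imgP[v _ uE] /eqP Fu].
rewrite opp_lfunE => Hu; have {}Hu : H u = - n%:R *: u by rewrite scaleNr -Hu opprK.
have kerv : H v + n.+2%:R *: v \in lker E.
  rewrite memv_ker linearD linearZ /= -uE; have := HE v; rewrite -uE Hu.
  move/eqP; rewrite -subr_eq => /eqP <-; apply/eqP; rewrite -!natr1; vring.
have [N' [z [zP zE]]] := ker_weight_split rel (subvv _) (ker_H_stable rel) kerv.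
pose k := \sum_(j < N') (j%:R + n.+2%:R : K)^-1 *: z j.
have Ek : E k = 0.
  apply/eqP; rewrite -memv_ker memv_suml // => j _; have [zE' _] := zP j.
  exact: memvZ.
have Hk : H k + n.+2%:R *: k = H v + n.+2%:R *: v.
  rewrite zE linear_sum scaler_sumr -big_split; apply: eq_bigr => j _ /=.
  rewrite linearZ /= (zP j).2 !scalerA mulrC -scalerDl -mulrDl mulfV ?scale1r //.
  by rewrite -natrD pnatr_eq0 addnS.
pose w := v - k.
have Ew : E w = u by rewrite linearB /= Ek subr0.
have Hw : H w = - n.+2%:R *: w.
  apply/eqP; rewrite -subr_eq0 scaleNr opprK linearB scalerBr /= addrACA -opprD.
  by rewrite Hk subrr.
suff w0 i : iter i F w = 0 -> w = 0 by rewrite memv0 -Ew (w0 N) ?linear0.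
elim: i => // i IHi /[dup] Fw /(congr1 E); rewrite (E_iterF rel) linear0 Ew.
rewrite iterSr Fu lfun_iter0 add0r Hw -scalerBl lfun_iterZ scalerA => /eqP.
rewrite scaler_eq0 mulf_eq0 pnatr_eq0 -opprD oppr_eq0 -natrD pnatr_eq0 addSn /=.
by move/eqP/IHi.
Qed.

Lemma kerE_limgF E F H : sl2_rel E F H -> (lker E + limg F)%VS = fullv.
Proof.
move=> rel; apply/eqP; rewrite eqEdim subvf /=.
have dEF := dimv_disjoint_sum (limgE_kerF rel).
have dFE := dimv_disjoint_sum (limgE_kerF (sl2_rel_swap rel)).
have kE := limg_ker_dim E fullv; have kF := limg_ker_dim F fullv.
rewrite !capfv in kE kF; have lEF := dimvS (subvf (limg E + lker F)%VS).
by rewrite addvC dFE; lia.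
Qed.

Lemma highest_weight_span E F H (U : {vspace V}) : sl2_rel E F H ->
  (forall n x i, E x = 0 -> H x = n%:R *: x -> iter i F x \in U) -> U = fullv.
Proof.
move=> rel hU; apply/eqP; rewrite eqEsubv subvf; apply/subvP => x _.
have [N nilF] := iterE_nilpotent (sl2_rel_swap rel).
suff gen i : (forall x, iter i F x \in U) -> forall x, x \in U.
  by apply: (gen N) => y; rewrite nilF mem0v.
elim: i => // i IHi iU; apply: IHi => y.
have: y \in (lker E + limg F)%VS by rewrite (kerE_limgF rel) memvf.
case/memv_addP=> k Ek [_ /memv_imgP[z _ ->] ->]; rewrite lfun_iterD -iterSr memvD //.
have [M [t [tP ->]]] := ker_weight_split rel (subvv _) (ker_H_stable rel) Ek.
rewrite (big_morph (iter i F) (lfun_iterD F i) (lfun_iter0 F i)) memv_suml // => j _.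
by have [] := tP j; rewrite memv_ker => /eqP /hU; apply.
Qed.

Lemma iterF_vanish E F H : sl2_rel E F H -> forall n x,
  E x = 0 -> H x = n%:R *: x -> iter n.+1 F x = 0.
Proof.
move=> rel n x Ex Hx; apply: (ker_negative_weight rel (n := n.+1)).
  by rewrite (E_iterF rel) Ex lfun_iter0 Hx subrr lfun_iter0 scaler0 addr0.
rewrite (weight_iterF rel) Hx lfun_iterZ -scalerBl; congr (_ *: _).
by rewrite -!natr1; ring.
Qed.

End Sl2.

(** * Chains and the modules they span *)

Section Chains.
Variables (K : fieldType) (V : vectType K) (A B C : 'End(V)).

Definition stable3 (U : {vspace V}) : Prop :=
  [/\ {homo A : x / x \in U}, {homo B : x / x \in U} & {homo C : x / x \in U}].

Definition leonard_chain d (u : nat -> V) : Prop :=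
  exists (l a b c : nat -> K) (z : K),
  [/\ forall i j, (i < j < d)%N -> l i != l j,
      forall k, (k < d)%N -> B (u k) = l k *: u k,
      forall k, (k < d)%N -> A (u k) = a k *: u k.-1 + c k *: u k + b k *: u k.+1,
      forall k, (k < d)%N -> C (u k) = z *: u k - A (u k) - B (u k)
    & [/\ a 0 = 0, b d.-1 = 0, forall k, (0 < k < d)%N -> a k != 0
        & forall k, (k.+1 < d)%N -> b k != 0]].

Definition chain_span d (u : nat -> V) : {vspace V} := <<[tuple u i | i < d]>>%VS.

Lemma mem_chain_span d u k : (k < d)%N -> u k \in chain_span d u.
Proof.
move=> kd; apply: memv_span; apply/tnthP; exists (Ordinal kd).
by rewrite tnth_mktuple.
Qed.

Lemma chain_span_sub d u (U : {vspace V}) :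
  (forall k, (k < d)%N -> u k \in U) -> (chain_span d u <= U)%VS.
Proof.
by move=> uU; apply/span_subvP => x /tnthP[i ->]; rewrite tnth_mktuple uU.
Qed.

Lemma chain_span_homo d u (L : 'End(V)) (U : {vspace V}) :
  (forall k, (k < d)%N -> L (u k) \in U) -> forall x, x \in chain_span d u -> L x \in U.
Proof.
move=> Lu x xu; rewrite memv_preim; apply: subvP xu.
by apply: chain_span_sub => k kd; rewrite -memv_preim Lu.
Qed.

Lemma chain_span_stable d u : leonard_chain d u -> stable3 (chain_span d u).
Proof.
case=> l [a [b [c [z [_ Bu Au Cu [a0 bd _ _]]]]]].
have uU k : (k < d)%N -> u k \in chain_span d u by apply: mem_chain_span.
have AU k : (k < d)%N -> A (u k) \in chain_span d u.
  move=> kd; rewrite Au //; apply: memvD.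
    by rewrite memvD ?memvZ ?uU // (leq_ltn_trans (leq_pred k) kd).
  have [kd1|] := ltnP k.+1 d; first by rewrite memvZ ?uU.
  rewrite leq_eqVlt ltnS leqNgt kd orbF => /eqP dE.
  by move: bd; rewrite dE => ->; rewrite scale0r mem0v.
have BU k : (k < d)%N -> B (u k) \in chain_span d u by move=> kd; rewrite Bu ?memvZ ?uU.
split; apply: chain_span_homo => // k kd.
by rewrite Cu // !memvB ?memvZ ?uU ?AU ?BU.
Qed.

Lemma eigen_summand (U : {vspace V}) l1 l2 x y : {homo B : x / x \in U} ->
  B x = l1 *: x -> B y = l2 *: y -> l1 != l2 -> x + y \in U -> x \in U.
Proof.
move=> BU Bx By nl xyU; suff: (l1 - l2) *: x \in U.
  by move/(memvZ (l1 - l2)^-1); rewrite scalerK // subr_eq0.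
suff -> : (l1 - l2) *: x = B (x + y) - l2 *: (x + y) by rewrite memvB ?BU ?memvZ.
by rewrite linearD /= Bx By; vring.
Qed.

Lemma chain_spread d u (U : {vspace V}) k : leonard_chain d u -> stable3 U ->
  (k < d)%N -> u k \in U -> forall j, (j < d)%N -> u j \in U.
Proof.
case=> l [a [b [c [z [injl Bu Au _ [a0 bd an bn]]]]]] [AU BU _].
have nbrs i : (i < d)%N -> u i \in U -> a i *: u i.-1 + b i *: u i.+1 \in U.
  move=> id ui; suff -> : a i *: u i.-1 + b i *: u i.+1 = A (u i) - c i *: u i.
    by rewrite memvB ?AU ?memvZ.
  by rewrite Au //; vring.
have BZ s i : (i < d)%N -> B (s *: u i) = l i *: (s *: u i).
  by move=> id; rewrite linearZ /= Bu // !scalerA mulrC.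
have unZ s i : s != 0 -> s *: u i \in U -> u i \in U.
  by move=> sn /(memvZ s^-1); rewrite scalerK.
have down i : (i.+1 < d)%N -> u i.+1 \in U -> u i \in U.
  move=> id ui; have /= := nbrs _ id ui; have ai : a i.+1 != 0 by apply: an.
  have [id2|] := ltnP i.+2 d.
    move/(eigen_summand BU (BZ _ _ (ltnW id)) (BZ _ _ id2)) => h.
    by apply: (unZ _ _ ai); apply: h; rewrite injl //; lia.
  rewrite leq_eqVlt ltnS leqNgt id orbF => /eqP dE; move: bd; rewrite dE /= => ->.
  by rewrite scale0r addr0 => /(unZ _ _ ai).
have up i : (i.+1 < d)%N -> u i \in U -> u i.+1 \in U.
  move=> id ui; have /= := nbrs _ (ltnW id) ui; have bi : b i != 0 by apply: bn.
  case: i id {ui} bi => [|i] id bi; first by rewrite a0 scale0r add0r => /(unZ _ _ bi).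
  have id' : (i < d)%N by lia.
  rewrite addrC => /(eigen_summand BU (BZ _ _ id) (BZ _ _ id')) h.
  by apply: (unZ _ _ bi); apply: h; rewrite eq_sym injl //; lia.
move=> kd uk; have u0 : u 0%N \in U.
  by elim: k kd uk => // k IHk kd uk; apply: IHk (ltnW kd) (down _ kd uk).
by elim=> // j IHj jd; apply: up jd (IHj (ltnW jd)).
Qed.

Lemma stable3_0 : stable3 0%VS.
Proof. by split=> x; rewrite !memv0 => /eqP->; rewrite linear0. Qed.

Lemma chain_nz d u k : leonard_chain d u -> (k < d)%N -> u k != 0 ->
  forall j, (j < d)%N -> u j != 0.
Proof.
move=> ch kd uk j jd; apply: contraNneq uk => uj; rewrite -memv0.
by apply: (chain_spread ch stable3_0 jd _ kd); rewrite uj mem0v.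
Qed.

Lemma lfun_linear (L : 'End(V)) : linear L.
Proof. by move=> t x y; rewrite linearP. Qed.

Lemma chain_free d u k : leonard_chain d u -> (k < d)%N -> u k != 0 ->
  free [tuple u i | i < d].
Proof.
move=> ch kd uk; have nz := chain_nz ch kd uk.
case: ch => l [a [b [c [z [injl Bu _ _ _]]]]].
by apply: eigen_family_free (@lfun_linear B) _ injl => i id; rewrite Bu // nz.
Qed.

Lemma chain_irreducible d u (U : {vspace V}) : leonard_chain d u -> stable3 U ->
  (U <= chain_span d u)%VS -> U = 0%VS \/ U = chain_span d u.
Proof.
move=> ch sU Uu; have [->|Un] := eqVneq U 0%VS; [by left|right].
apply/eqP; rewrite eqEsubv Uu /=.
have xU := memv_pick U; have xn : vpick U != 0 by rewrite vpick0.
move: (vpick U) xU xn => x xU xn.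
have [_ BU _] := sU; have [l [a [b [c [z [injl Bu _ _ _]]]]]] := ch.
have := coord_span (subvP Uu _ xU); set t := [tuple u i | i < d] => xE.
pose y i := if insub i is Some j then coord t j x *: u i else 0.
have yE (i : 'I_d) : y i = coord t i x *: u i by rewrite /y valK.
have yU i : (i < d)%N -> y i \in U.
  apply: (eigen_components (T := B) (l := l) (@lfun_linear B) BU _ injl) => [j jd|].
    by rewrite (yE (Ordinal jd)) linearZ /= Bu // !scalerA mulrC.
  rewrite (_ : \sum_(_ < _) _ = x) // [RHS]xE; apply: eq_bigr => j _.
  by rewrite yE -tnth_nth tnth_mktuple.
have [i yi] : exists i : 'I_d, y i != 0.
  apply/existsP; apply: contraR xn; rewrite negb_exists => /forallP y0.
  rewrite xE big1 // => i _; have /negbNE/eqP := y0 i.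
  by rewrite yE -tnth_nth tnth_mktuple.
apply: chain_span_sub; apply: (chain_spread ch sU (ltn_ord i)).
have := yU _ (ltn_ord i); move: yi; rewrite yE scaler_eq0 negb_or => /andP[cn _].
by move/(memvZ (coord t i x)^-1); rewrite scalerK.
Qed.

End Chains.

Lemma chain_LT_basis (R : realType) (V : vectType R[i]) (A B C : 'End(V)) d u k : 
  leonard_chain A B C d u -> (k < d)%N -> u k != 0 ->
  LT_basis (chain_span d u) B A C.
Proof.
move=> ch kd uk; have fr := chain_free ch kd uk; set W := chain_span d u.
have bW : basis_of W [tuple u i | i < d] by rewrite /basis_of eqxx.
have dimW := size_basis bW.
suff: exists b : d.-tuple V, [/\ basis_of W b, is_diag_in b B,
    is_irred_tridiag_in b A & is_irred_tridiag_in b C].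
  by clearbody W; case: _ / dimW.
exists [tuple u i | i < d]; move: bW; set t := [tuple u i | i < d] => bW.
case: ch => l [a [b [c [z [_ Bu Au Cu [a0 bd an bn]]]]]].
have cu (i : 'I_d) j : (j < d)%N -> coord t i (u j) = (i == j :> nat)%:R.
  move=> jd; rewrite -[u j](tnth_mktuple (fun i : 'I_d => u i) (Ordinal jd)).
  by rewrite (tnth_nth 0) (coord_free (Ordinal jd) i fr) eq_sym.
have eB (i j : 'I_d) : mx_entry t B i j = l j * (i == j :> nat)%:R.
  by rewrite /mx_entry tnth_mktuple Bu // linearZ /= cu.
have eA (i j : 'I_d) : mx_entry t A i j = a j * (i == j.-1 :> nat)%:R +
     c j * (i == j :> nat)%:R + b j * (i == j.+1 :> nat)%:R.
  rewrite /mx_entry tnth_mktuple Au // !linearD !linearZ /= (cu _ j) //.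
  rewrite (cu _ j.-1) ?(leq_ltn_trans (leq_pred j)) //.
  congr (_ + _); have [jd|] := ltnP j.+1 d; first by rewrite cu.
  rewrite leq_eqVlt ltnS leqNgt ltn_ord orbF => /eqP dE.
  have -> : b j = 0 by rewrite -bd (_ : d.-1 = j) // (congr1 predn dE).
  by rewrite !mul0r.
have eC (i j : 'I_d) : mx_entry t C i j =
    z * (i == j :> nat)%:R - mx_entry t A i j - mx_entry t B i j.
  by rewrite /mx_entry !tnth_mktuple Cu // !linearB linearZ /= cu.
have triA : is_irred_tridiag_in t A.
  move=> i j; split=> [ij|/orP[]/eqP ij]; rewrite eA.
  - have /negbTE-> : (i != j.-1 :> nat)%N by case: ij; lia.
    have /negbTE-> : (i != j :> nat)%N by case: ij; lia.
    have /negbTE-> : (i != j.+1 :> nat)%N by case: ij; lia.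
    by rewrite !mulr0 !addr0.
  - have -> : (i == j.-1 :> nat)%N by rewrite -ij.
    have /negbTE-> : (i != j :> nat)%N by lia.
    have /negbTE-> : (i != j.+1 :> nat)%N by lia.
    by rewrite mulr1 !mulr0 !addr0 an // -ij ltn0Sn ij /=.
  - have /negbTE-> : (i != j.-1 :> nat)%N by lia.
    have /negbTE-> : (i != j :> nat)%N by lia.
    by rewrite -ij eqxx mulr1 !mulr0 !add0r bn // ij.
split=> //.
  by move=> i j ij; rewrite eB val_eqE (negbTE ij) mulr0.
move=> i j; have [t0 tn] := triA i j; split=> h; rewrite eC eB.
  have /negbTE-> : (i != j :> nat)%N by case: h; lia.
  by rewrite t0 // !mulr0 !subr0.
have /negbTE-> : (i != j :> nat)%N by case/orP: h => /eqP; lia.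
by rewrite !mulr0 subr0 sub0r oppr_eq0 tn.
Qed.

Section ChainModules.
Variables (R : realType) (V : vectType R[i]) (A B C : 'End(V)).
Variable gens : seq 'End(V).
Hypothesis gensP : forall U, submodule gens U <-> stable3 A B C U.

Definition chain_module (W : {vspace V}) : Prop :=
  exists d u k, [/\ leonard_chain A B C d u, (k < d)%N, u k != 0 & W = chain_span d u].

Lemma chain_module_irreducible W : chain_module W -> irreducible_submodule gens W.
Proof.
case=> d [u [k [ch kd uk ->]]]; split; first by apply/gensP; exact: chain_span_stable.
  by apply: contraNneq uk => W0; rewrite -memv0 -W0 mem_chain_span.
by move=> U /gensP; exact: chain_irreducible.
Qed.

Lemma stable3_add U1 U2 :
  stable3 A B C U1 -> stable3 A B C U2 -> stable3 A B C (U1 + U2)%VS.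
Proof.
move=> [A1 B1 C1] [A2 B2 C2].
by split=> _ /memv_addP[x xU [y yU ->]]; rewrite linearD memv_add ?(A1, B1, C1, A2, B2, C2).
Qed.

Lemma stable3_cap U1 U2 :
  stable3 A B C U1 -> stable3 A B C U2 -> stable3 A B C (U1 :&: U2)%VS.
Proof.
move=> [A1 B1 C1] [A2 B2 C2].
by split=> x /memv_capP[x1 x2]; apply/memv_capP; split; auto.
Qed.

Lemma irreducible_sub_or_disjoint W U : irreducible_submodule gens W ->
  stable3 A B C U -> (W <= U)%VS \/ (W :&: U = 0)%VS.
Proof.
case=> /gensP sW Wn irr sU.
have [|Z|WE] := irr (W :&: U)%VS _ (capvSl _ _); first by apply/gensP; exact: stable3_cap.
  by right.
by left; apply/capv_idPl.
Qed.

Lemma chain_module_stable W : chain_module W -> stable3 A B C W.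
Proof. by case/chain_module_irreducible => /gensP. Qed.

Lemma chain_modules_stable (Ws : seq {vspace V}) :
  (forall W, W \in Ws -> chain_module W) -> stable3 A B C (\sum_(W <- Ws) W)%VS.
Proof.
move=> cWs; rewrite big_seq; elim/big_ind: _ => [|U1 U2|W /cWs].
- exact: stable3_0.
- exact: stable3_add.
- exact: chain_module_stable.
Qed.

Lemma maximal_chain_sum : exists Ws : seq {vspace V},
  [/\ forall W, W \in Ws -> chain_module W, directv (\sum_(W <- Ws) W)
    & forall W, chain_module W -> (W <= \sum_(W <- Ws) W)%VS].
Proof.
suff gen n : forall Ws : seq {vspace V}, (forall W, W \in Ws -> chain_module W) ->
    directv (\sum_(W <- Ws) W) ->
    (\dim {:V} - \dim (\sum_(W <- Ws) W)%VS <= n)%N ->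
    exists Ws : seq {vspace V}, [/\ forall W, W \in Ws -> chain_module W,
      directv (\sum_(W <- Ws) W) & forall W, chain_module W -> (W <= \sum_(W <- Ws) W)%VS].
  apply: (gen _ [::] _ _ (leqnn _)) => //; apply/directvP.
  by rewrite /= !big_nil dimv0.
elim: n => [|n IHn] Ws cWs dWs.
  rewrite leqn0 subn_eq0 => le; exists Ws; split=> // W _.
  suff -> : (\sum_(W <- Ws) W)%VS = fullv by rewrite subvf.
  by apply/eqP; rewrite eqEdim subvf.
move=> len; have [|nmax] := boolp.EM (forall W, chain_module W ->
   (W <= \sum_(W <- Ws) W)%VS); first by exists Ws.
have /boolp.existsNP[W0 /boolp.not_implyP[cW0 nW0]] := nmax.
have [|disj] := irreducible_sub_or_disjoint (chain_module_irreducible cW0)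
  (chain_modules_stable cWs); first by [].
have dimE := dimv_disjoint_sum disj.
apply: (IHn (W0 :: Ws)).
- by move=> W; rewrite inE => /predU1P[->|/cWs].
- by apply/directvP; rewrite /= !big_cons dimE (directvP dWs).
have Wn : (0 < \dim W0)%N.
  by have [_ + _] := chain_module_irreducible cW0; rewrite -dimv_eq0 lt0n.
have := dimvS (subvf (W0 + \sum_(W <- Ws) W)%VS); rewrite big_cons dimE.
move: len; lia.
Qed.

Lemma leonard_chain_map (P : 'End(V)) d u : leonard_chain A B C d u ->
  (forall k L, (k < d)%N -> L \in [:: A; B; C] -> P (L (u k)) = L (P (u k))) ->
  leonard_chain A B C d (fun k => P (u k)).
Proof.
case=> l [a [b [c [z [injl Bu Au Cu side]]]]] com.
have Ac k : (k < d)%N -> P (A (u k)) = A (P (u k)) by move=> kd; rewrite com ?inE ?eqxx.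
have Bc k : (k < d)%N -> P (B (u k)) = B (P (u k)).
  by move=> kd; rewrite com ?inE ?eqxx ?orbT.
have Cc k : (k < d)%N -> P (C (u k)) = C (P (u k)).
  by move=> kd; rewrite com ?inE ?eqxx ?orbT.
exists l, a, b, c, z; split=> // k kd.
- by rewrite -Bc // Bu // linearZ.
- by rewrite -Ac // Au // !linearD !linearZ.
- by rewrite -Cc // Cu // !linearB linearZ /= Ac // Bc.
Qed.

Lemma irreducible_chain_module (Ws : seq {vspace V}) W :
  (forall W', W' \in Ws -> chain_module W') -> irreducible_submodule gens W ->
  (W :&: \sum_(W' <- Ws) W' != 0)%VS -> chain_module W.
Proof.
move=> cWs irrW; have [/gensP sW Wn irr] := irrW.
elim: Ws cWs => [|W0 Ws IHWs] cWs; first by rewrite big_nil capv0 eqxx.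
have {}IHWs := IHWs (fun W' h => cWs W' (mem_behead (s := _ :: _) h)).
rewrite big_cons; set T := (\sum_(W' <- Ws) W')%VS in IHWs *.
have [WT|/IHWs //] := eqVneq (W :&: T)%VS 0%VS; move=> WT0.
have sT : stable3 A B C T.
  by apply: chain_modules_stable => W' h; apply: cWs; rewrite inE h orbT.
have cW0 : chain_module W0 by apply: cWs; rewrite inE eqxx.
have sW0 := chain_module_stable cW0.
have irrW0 := chain_module_irreducible cW0.
have [WW0T|W0T] := irreducible_sub_or_disjoint irrW (stable3_add sW0 sT); last first.
  by rewrite W0T eqxx in WT0.
have nW0T : ~~ (W0 <= T)%VS.
  apply/negP => /addv_idPr W0T; rewrite W0T in WW0T.
  by move/capv_idPl: WW0T Wn; rewrite WT => <-; rewrite eqxx.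
have W0WT : (W0 <= W + T)%VS.
  have [//|disj] := irreducible_sub_or_disjoint irrW0 (stable3_add sW sT).
  have xW := memv_pick W; have xn : vpick W != 0 by rewrite vpick0.
  have /memv_addP[y yW0 [t tT xE]] := subvP WW0T _ xW.
  have yE : y = vpick W - t by rewrite xE addrK.
  have : y \in (W0 :&: (W + T))%VS.
    by rewrite memv_cap yW0 yE memv_add ?memvN.
  rewrite disj memv0 => /eqP y0; move: xn; rewrite -memv0 -WT memv_cap xW xE y0.
  by rewrite add0r tT.
have [d [u [k [ch kd uk W0E]]]] := cW0.
pose P := daddv_pi W T.
have PT t : t \in T -> P t = 0.
  move=> tT; have TW : (T :&: W = 0)%VS by rewrite capvC.
  have := daddv_pi_add WT (subvP (addvSr W T) _ tT).
  by rewrite (daddv_pi_id TW tT) => /(canRL (addrK t)); rewrite subrr.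
have com (L : 'End(V)) x : {homo L : y / y \in W} -> {homo L : y / y \in T} ->
    x \in (W + T)%VS -> P (L x) = L (P x).
  move=> LW LT /memv_addP[y yW [t tT ->]].
  by rewrite !linearD /= !(PT _ tT) (PT _ (LT _ tT)) !daddv_pi_id ?LW // linear0.
have uWT j : (j < d)%N -> u j \in (W + T)%VS.
  by move=> jd; rewrite (subvP W0WT) // W0E mem_chain_span.
have chP : leonard_chain A B C d (fun j => P (u j)).
  apply: leonard_chain_map ch _ => j L jd.
  have [AW BW CW] := sW; have [AT BT CT] := sT.
  by rewrite !inE => /or3P[]/eqP->; rewrite com ?uWT.
have Pk : P (u k) != 0.
  apply: contraNneq nW0T => Pu; rewrite W0E; apply: chain_span_sub.
  apply: (chain_spread ch sT kd); have := daddv_pi_add WT (uWT k kd).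
  by rewrite -/P Pu add0r => <-; apply: memv_pi.
exists d, (fun j => P (u j)), k; split=> //.
have [||Z|//] := irr (chain_span d (fun j => P (u j))).
- by apply/gensP; exact: chain_span_stable.
- by apply: chain_span_sub => j _; apply: memv_pi.
by move: Pk; rewrite -memv0 -Z (mem_chain_span (fun j => P (u j))).
Qed.

Lemma chain_module_criterion :
  (forall U : {vspace V}, (forall d u, leonard_chain A B C d u ->
      forall k, (k < d)%N -> u k \in U) -> U = fullv) ->
  completely_reducible gens /\
  forall W, irreducible_submodule gens W -> LT_basis W B A C.
Proof.
move=> spanV; have [Ws [cWs dWs maxWs]] := maximal_chain_sum.
have sumV : (\sum_(W <- Ws) W)%VS = fullv.
  apply: spanV => d u ch k kd; have [->|uk] := eqVneq (u k) 0; first exact: mem0v.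
  apply: (subvP (maxWs (chain_span d u) _)); last exact: mem_chain_span.
  by exists d, u, k.
split; first by exists Ws; split=> // W /cWs; exact: chain_module_irreducible.
move=> W irrW; have [_ Wn _] := irrW.
have [|d [u [k [ch kd uk ->]]]] := irreducible_chain_module cWs irrW.
  by rewrite sumV capvf.
exact: chain_LT_basis ch kd uk.
Qed.

End ChainModules.

(** * Chains in sl_2-modules *)

Lemma quarter_square (K : numFieldType) (V : vectType K) (X : 'End(V)) x :
  (16^-1 *: ((X - 2 *: \1) \o (X + 2 *: \1))%VF) x = 16^-1 *: (X (X x) - 4 *: x).
Proof.
rewrite !(add_lfunE, opp_lfunE, scale_lfunE, comp_lfunE, id_lfunE); congr (_ *: _).
rewrite ?lfun_linE; vring.
Qed.

Lemma imaginary_square (K : numClosedFieldType) (V : vectType K) (E F : 'End(V)) x :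
  ('i *: E - 'i *: F) (('i *: E - 'i *: F) x) =
  - E (E x) + E (F x) + F (E x) - F (F x).
Proof.
rewrite !(add_lfunE, opp_lfunE, scale_lfunE) ?lfun_linE.
have ii : 'i * 'i = -1 :> K by rewrite -expr2 sqrCi.
by vlin; ring: ii.
Qed.

Section SharpOperators.
Variables (K : numFieldType) (V : vectType K) (E F H A B C : 'End(V)).

Definition sharp_formulas : Prop :=
  [/\ forall x, A x = 16^-1 *: (E (E x) + E (F x) + F (E x) + F (F x) - 4 *: x),
      forall x, B x = 16^-1 *: (H (H x) - 4 *: x)
    & forall x, C x = 16^-1 *: (- E (E x) + E (F x) + F (E x) - F (F x) - 4 *: x)].

Hypothesis sharp : sharp_formulas.
Hypothesis rel : sl2_rel E F H.

Lemma sharp_commutator x :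
  64^-1 *: (H (F (F x)) + 2 *: F (F x) - (H (E (E x)) - 2 *: E (E x))) =
  2^-1 *: (A (B x) - B (A x)).
Proof.
have [HE HF EF] := rel; have [AE BE _] := sharp.
rewrite AE [B (A x)]BE [B x]BE AE.
rewrite ?(lfun_linE, HE, HF).
rewrite ?(lfun_linE, HE, HF).
rewrite ?(lfun_linE, HE, HF).
by vlin; field.
Qed.

Section Ladder.
Variables (n : nat) (w : nat -> V).

Definition sharp_ladder : Prop :=
  [/\ E (E (w 0)) + F (F (w 0)) = 2 *: w 2, E (E (w 1)) + F (F (w 1)) = 6 *: w 3,
      forall j, E (E (w j.+2)) + F (F (w j.+2)) =
        ((n%:R - j%:R) * (n%:R - j.+1%:R)) *: w j + (j.+3%:R * j.+4%:R) *: w j.+4,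
      forall i, E (F (w i)) + F (E (w i)) =
        (i.+1%:R * (n%:R - i%:R) + i%:R * (n%:R - i%:R + 1)) *: w i
    & forall i, H (H (w i)) = ((n%:R - 2 * i%:R) ^+ 2) *: w i].

Hypothesis lad : sharp_ladder.

Lemma ladder_chain d e (s : K) (y : bool) :
  (e < 2)%N ->
  (forall k, (k <= d)%N -> (2 * k + e <= n)%N) ->
  (forall k k', (k < k' <= d)%N -> (2 * k + e + (2 * k' + e))%N <> n) ->
  (y -> (0 < d)%N) ->
  w (2 * d.+1 + e) = s *: w (2 * d + e) + y%:R *: w (2 * d.-1 + e) ->
  leonard_chain (A) (B) (C) d.+1 (fun k => w (2 * k + e)).
Proof.
have [sA BE CE] := sharp; case: lad => S0 S1 SS M HH e2 kn kk' yd wend.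
pose q i : K := i.+1%:R * i.+2%:R.
pose mu i : K := i.+1%:R * (n%:R - i%:R) + i%:R * (n%:R - i%:R + 1).
exists (fun k => 16^-1 * ((n%:R - 2 * (2 * k + e)%:R) ^+ 2 - 4)).
exists (fun k => if k is k'.+1 then
   16^-1 * ((n%:R - (2 * k' + e)%:R) * (n%:R - (2 * k' + e).+1%:R)
     + ((k == d) && y)%:R * q (2 * k + e)%N) else 0).
exists (fun k => if k == d then 0 else 16^-1 * q (2 * k + e)%N).
exists (fun k => 16^-1 * (mu (2 * k + e)%N - 4 + (k == d)%:R * s * q (2 * k + e)%N)).
exists (16^-1 * (n%:R ^+ 2 + 2 * n%:R - 12)).
have AE x : A x = 16^-1 *: ((E (E x) + F (F x)) + (E (F x) + F (E x)) - 4 *: x).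
  by rewrite sA; vring.
split.
- move=> i j /andP[ij jd]; rewrite -subr_eq0.
  have -> : 16^-1 * ((n%:R - 2 * (2 * i + e)%:R) ^+ 2 - 4) -
            16^-1 * ((n%:R - 2 * (2 * j + e)%:R) ^+ 2 - 4)
          = 4^-1 * ((2 * j + e)%:R - (2 * i + e)%:R)
             * (n%:R - ((2 * i + e) + (2 * j + e))%N%:R) :> K.
    by rewrite [(_ + _ + (_ + _))%:R]natrD; field.
  rewrite !mulf_neq0 ?invr_eq0 ?pnatr_eq0 // subr_eq0 eqr_nat; first by lia.
  apply/eqP => nE; apply: (kk' i j); last by rewrite nE.
  by rewrite ij.
- by move=> k _; rewrite BE HH -scalerBl scalerA.
- move=> k kd; rewrite AE M.
  case: k kd => [|k] kd /=; last first.
    have -> : (2 * k.+1 + e = (2 * k + e).+2)%N by lia.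
    rewrite SS (_ : (2 * k.+2 + e = (2 * k + e).+4)%N); last by lia.
    case: (eqVneq k.+1 d) => [kdE|_] /=; last by rewrite /q /mu; vring.
    have -> : w (2 * k + e).+4 = s *: w (2 * k + e).+2 + y%:R *: w (2 * k + e)%N.
      have <- : (2 * d.+1 + e = (2 * k + e).+4)%N by lia.
      have <- : (2 * d + e = (2 * k + e).+2)%N by lia.
      by rewrite wend -kdE.
    by rewrite /q /mu; vring.
  have -> : E (E (w (2 * 0 + e)%N)) + F (F (w (2 * 0 + e)%N)) =
     q (2 * 0 + e)%N *: w (2 * 1 + e)%N.
    rewrite /q; case: e e2 {kn kk' wend kd} => [|[|//]] _.
      by rewrite [LHS]S0 -natrM.
    by rewrite [LHS]S1 -natrM.
  case: (eqVneq 0%N d) => [dE|_] /=; last by rewrite /q /mu; vring.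
  have -> : w (2 * 1 + e)%N = s *: w (2 * 0 + e)%N.
    move: wend; rewrite -dE => ->; case: (y) yd => [/(_ isT)|_]; first by rewrite -dE.
    by rewrite scale0r addr0.
  by rewrite /q /mu; vring.
- move=> k _; set i := (2 * k + e)%N; rewrite CE BE HH AE M.
  rewrite (_ : - E (E (w i)) + E (F (w i)) + F (E (w i)) - F (F (w i)) =
     (E (F (w i)) + F (E (w i))) - (E (E (w i)) + F (F (w i)))); last by vring.
  rewrite M -natr1; vring.
split=> //.
- by rewrite eqxx.
- case=> // k /andP[_ kd] /=; have := kn k.+1 kd => le; rewrite mulf_neq0 ?invr_eq0 ?pnatr_eq0 //.
  have -> : n%:R - (2 * k + e)%:R = (n - (2 * k + e))%N%:R :> K.
    by rewrite natrB //; lia.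
  have -> : n%:R - (2 * k + e).+1%:R = (n - (2 * k + e).+1)%N%:R :> K.
    by rewrite natrB //; lia.
  rewrite /q -!natrM -natrD pnatr_eq0 addn_eq0 muln_eq0 !subn_eq0.
  by apply/negP; lia.
- by move=> k kd; rewrite ltn_eqF // mulf_neq0 ?invr_eq0 /q ?mulf_neq0 ?pnatr_eq0.
Qed.

End Ladder.
End SharpOperators.

Section HighestWeight.
Variables (K : numFieldType) (V : vectType K) (E F H A B C : 'End(V)).
Hypotheses (rel : sl2_rel E F H) (sharp : sharp_formulas E F H A B C).
Variables (n : nat) (x : V).
Hypotheses (Ex : E x = 0) (Hx : H x = n%:R *: x).

Definition wvec i : V := i`!%:R^-1 *: iter i F x.

Lemma wvec_F i : F (wvec i) = i.+1%:R *: wvec i.+1.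
Proof.
rewrite /wvec lfunZ scalerA factS natrM invfM mulrA mulfV ?mul1r //.
by rewrite pnatr_eq0.
Qed.

Lemma wvec_E0 : E (wvec 0) = 0.
Proof. by rewrite /wvec lfunZ Ex scaler0. Qed.

Lemma wvec_E i : E (wvec i.+1) = (n%:R - i%:R) *: wvec i.
Proof.
rewrite /wvec lfunZ (E_iterF rel) Ex lfun_iter0 add0r Hx -scalerBl lfun_iterZ !scalerA.
congr (_ *: _); rewrite factS natrM.
have f0 : i`!%:R != 0 :> K by rewrite pnatr_eq0 -lt0n fact_gt0.
have i0 : i.+1%:R != 0 :> K by rewrite pnatr_eq0.
by field; rewrite f0 -[1 + _]/(1%:R + _) -natrD.
Qed.

Lemma wvec_H i : H (wvec i) = (n%:R - 2 * i%:R) *: wvec i.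
Proof.
rewrite /wvec lfunZ (weight_iterF rel) Hx lfun_iterZ -scalerBl !scalerA.
by rewrite mulrC.
Qed.

Lemma wvec_big i : (n < i)%N -> wvec i = 0.
Proof.
move=> ni; rewrite /wvec -(subnK ni) iterD (iterF_vanish rel) // lfun_iter0.
by rewrite scaler0.
Qed.

Definition wrev i : V := if (i <= n)%N then wvec (n - i) else 0.

Lemma wrev_E i : E (wrev i) = i.+1%:R *: wrev i.+1.
Proof.
rewrite /wrev; case: (ltngtP i n) => [lt|gt|->].
- rewrite (_ : n - i = (n - i.+1).+1)%N ?wvec_E; last by lia.
  by rewrite natrB // subKr.
- by rewrite lfun0 scaler0.
- by rewrite subnn wvec_E0 scaler0.
Qed.

Lemma wrev_F0 : F (wrev 0) = 0.
Proof. by rewrite /wrev subn0 wvec_F wvec_big // scaler0. Qed.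

Lemma wrev_F i : F (wrev i.+1) = (n%:R - i%:R) *: wrev i.
Proof.
rewrite /wrev; case: (ltngtP i n) => [lt|gt|->].
- by rewrite wvec_F (_ : (n - i.+1).+1 = n - i)%N ?natrB //; lia.
- by rewrite lfun0 scaler0.
- by rewrite subrr scale0r lfun0.
Qed.

Lemma wrev_H i : H (wrev i) = - (n%:R - 2 * i%:R) *: wrev i.
Proof.
rewrite /wrev; case: leqP => [le|_]; last by rewrite lfun0 scaler0.
by rewrite wvec_H natrB //; congr (_ *: _); ring.
Qed.

Lemma weight_ladder (s : K) : sharp_ladder E F H n (fun i => wvec i + s *: wrev i).
Proof.
(* [wvec] and [wrev] are generalised so that rewriting does not unfold them. *)
move: wvec wrev wvec_F wvec_E0 wvec_E wrev_E wrev_F0 wrev_F wvec_H wrev_H.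
move=> v r vF vE0 vE rE rF0 rF vH rH; split=> [||j|[|j]|i];
  rewrite ?(lfun_linE, vF, vE0, vE, rE, rF0, rF, vH, rH) -?natr1; vring.
Qed.

Lemma wvec_sym (s : K) i : s * s = 1 -> (i <= n)%N ->
  wvec (n - i) + s *: wrev (n - i) = s *: (wvec i + s *: wrev i).
Proof.
move=> ss le; rewrite /wrev leq_subr le subKn //.
by rewrite scalerDr scalerA ss scale1r addrC.
Qed.

Variable U : {vspace V}.
Hypothesis chU : forall d u, leonard_chain A B C d u ->
  forall k, (k < d)%N -> u k \in U.

Lemma wvec_odd_mem i : odd n -> (i <= n)%N -> wvec i \in U.
Proof.
move=> on le.
have lad : sharp_ladder E F H n wvec.
  have := weight_ladder 0; case=> S0 S1 S2 S3 S4.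
  by split; [move: S0|move: S1|move=> j; move: (S2 j)|move=> j; move: (S3 j)
    |move=> j; move: (S4 j)]; rewrite !scale0r !addr0.
have h : wvec (2 * i./2 + odd i) \in U.
  apply: (chU (d := n./2.+1)
    (ladder_chain sharp lad (d := n./2) (s := 0) (y := false) _ _ _ _ _)) => //.
  - by case: odd.
  - by move=> k kd; lia.
  - by move=> k k' kk; lia.
  - by rewrite !scale0r addr0 wvec_big //; lia.
  - by lia.
by rewrite mulnC muln2 addnC odd_double_half in h.
Qed.

Lemma ladder_even_mem (s : K) i : s * s = 1 -> ~~ odd n -> (i <= n./2)%N ->
  (s == 1) || (i < n./2)%N -> wvec i + s *: wrev i \in U.
Proof.
move=> ss en le s1i.
pose w i := wvec i + s *: wrev i; rewrite -/(w i).
have lad : sharp_ladder E F H n w := weight_ladder s.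
have nE : (n = n./2.*2)%N by rewrite -[LHS]odd_double_half (negbTE en).
set m := n./2 in le s1i nE.
have sym j : (j <= n)%N -> w (n - j)%N = s *: w j by apply: wvec_sym.
have wbig j : (n < j)%N -> w j = 0.
  by move=> nj; rewrite /w wvec_big // /wrev leqNgt nj scaler0 addr0.
have h d t (y : bool) : (i <= 2 * d + odd i)%N -> (2 * d + odd i <= m)%N ->
    (y -> (0 < d)%N) ->
    w (2 * d.+1 + odd i)%N =
      t *: w (2 * d + odd i)%N + y%:R *: w (2 * d.-1 + odd i)%N ->
    w i \in U.
  move=> id dm yd wE.
  have ii : w (2 * i./2 + odd i)%N \in U.
    apply: (chU (ladder_chain sharp lad (d := d) (s := t) (y := y) _ _ _ yd wE)).
    - by case: odd.
    - by move=> k kd; lia.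
    - by move=> k k' kk; lia.
    - by lia.
  by rewrite mulnC muln2 addnC odd_double_half in ii.
(* the reflection [j <-> n - j] folds the ladder back at its middle [m] *)
have ie : (i = 2 * i./2 + odd i)%N by lia.
have [[m0 m1]|sm] : (s = 1 /\ ~~ odd (m - odd i)) \/
    (odd (m - odd i) \/ ((s != 1) /\ ~~ odd (m - odd i))).
  by case: eqVneq; case: odd; auto.
- have [m2|m2] := ltnP m 2.
    apply: (h ((m - odd i)./2) 0 false) => //; try by lia.
    by rewrite !scale0r addr0 wbig //; lia.
  apply: (h ((m - odd i)./2) 0 true) => //; try by lia.
  rewrite scale0r add0r scale1r.
  have -> : (2 * (m - odd i)./2.+1 + odd i = n - (2 * (m - odd i)./2.-1 + odd i))%N.
    by lia.
  by rewrite sym ?m0 ?scale1r //; lia.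
case: sm => [om|[sn1 em]].
  apply: (h ((m - odd i)./2) s false) => //; try by lia.
  rewrite scale0r addr0.
  have -> : (2 * (m - odd i)./2.+1 + odd i = n - (2 * (m - odd i)./2 + odd i))%N.
    by lia.
  by rewrite sym //; lia.
rewrite (negbTE sn1) /= in s1i.
have sN : s = -1.
  have : (s - 1) * (s + 1) == 0 by apply/eqP; rewrite -subr_sqr expr2 ss expr1n subrr.
  by rewrite mulf_eq0 subr_eq0 (negbTE sn1) addr_eq0 => /eqP.
have wm : w m = 0.
  have mn : (m <= n)%N by lia.
  have := sym m mn; rewrite (_ : n - m = m)%N; last by lia.
  rewrite sN scaleN1r => /eqP.
  by rewrite -subr_eq0 opprK -mulr2n -scaler_nat scaler_eq0 pnatr_eq0 => /eqP.
apply: (h ((m - odd i)./2.-1) 0 false) => //; try by lia.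
rewrite !scale0r addr0 -wm; congr w; lia.
Qed.

Lemma wvec_mem i : wvec i \in U.
Proof.
have [le|/wvec_big ->] := leqP i n; last exact: mem0v.
have [on|en] := boolP (odd n); first exact: wvec_odd_mem.
suff h j : (j <= n./2)%N -> wvec j \in U /\ wrev j \in U.
  have [/h[]//|lt] := leqP i n./2.
  have [|_] := h (n - i)%N; first by lia.
  by rewrite /wrev leq_subr subKn.
move=> jm; have wp := ladder_even_mem (mulr1 1) en jm.
have {}wp : wvec j + wrev j \in U by rewrite -[wrev j]scale1r wp ?eqxx.
have wn : wvec j - wrev j \in U.
  have [jE|jm'] := eqVneq j n./2.
    rewrite /wrev (_ : n - j = j)%N; last by lia.
    by case: leqP => [_|]; [rewrite subrr mem0v|lia].
  rewrite -scaleN1r ladder_even_mem ?mulrNN ?mulr1 //.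
  by rewrite ltn_neqAle jm' jm orbT.
have half (z : V) : 2%:R *: z \in U -> z \in U.
  by move/(memvZ (2%:R^-1)); rewrite scalerK // pnatr_eq0.
by split; apply: half; [have := memvD wp wn | have := memvB wp wn];
  congr (_ \in U); vring.
Qed.

End HighestWeight.

Lemma chains_span (K : numFieldType) (V : vectType K) (E F H A B C : 'End(V)) :
  sl2_rel E F H -> sharp_formulas E F H A B C ->
  forall U : {vspace V}, (forall d u, leonard_chain A B C d u ->
      forall k, (k < d)%N -> u k \in U) -> U = fullv.
Proof.
move=> rel sharp U chU; apply: (highest_weight_span rel) => n x i Ex Hx.
have := wvec_mem rel sharp Ex Hx chU i.
move/(memvZ i`!%:R); rewrite scalerA mulfV ?scale1r //.
by rewrite pnatr_eq0 -lt0n fact_gt0.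
Qed.

(** * Cyclic symmetry *)

Section Rotation.
Variables (K : numClosedFieldType) (V : vectType K) (E F H : 'End(V)).

(* [E + F], [H], [i(E - F)] generate sl_2 with relations invariant under cyclic
   permutation; this is the sl_2-triple of the permuted operators. *)
Definition rotE : 'End(V) := 2^-1 *: (H - 'i *: (E + F)).
Definition rotF : 'End(V) := 2^-1 *: (H + 'i *: (E + F)).
Definition rotH : 'End(V) := 'i *: E - 'i *: F.

Lemma rot_sl2 : sl2_rel E F H -> sl2_rel rotE rotF rotH.
Proof.
case=> HE HF EF; have ii : 'i * 'i = -1 :> K by rewrite -expr2 sqrCi.
split=> x; rewrite /rotE /rotF /rotH;
  rewrite ?(add_lfunE, opp_lfunE, scale_lfunE, lfun_linE, HE, HF, EF);
  (by vlin; field: ii).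
Qed.

Lemma rot_sum : rotE + rotF = H.
Proof.
apply/lfunP => x; rewrite !(add_lfunE, opp_lfunE, scale_lfunE); by vlin; field.
Qed.

Lemma rot_diff : 'i *: rotE - 'i *: rotF = E + F.
Proof.
have ii : 'i * 'i = -1 :> K by rewrite -expr2 sqrCi.
apply/lfunP => x; rewrite !(add_lfunE, opp_lfunE, scale_lfunE); by vlin; field: ii.
Qed.

End Rotation.

Section Sharp.
Variables (R : realType) (V : vectType R[i]).
Implicit Types E F H : 'End(V).

Lemma sl2_module_rel E F H : is_sl2_module E F H -> sl2_rel E F H.
Proof.
case=> /lfunP HE /lfunP HF /lfunP EF.
split=> x; [move: (HE x)|move: (HF x)|move: (EF x)];
  rewrite !(add_lfunE, opp_lfunE, scale_lfunE, comp_lfunE) => /eqP;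
  by rewrite subr_eq addrC => /eqP.
Qed.

Lemma sharp_formulasP E F H :
  sharp_formulas E F H (sharpA E F) (sharpB H) (sharpC E F).
Proof.
split=> x; rewrite [LHS]quarter_square //; congr (_ *: (_ - _)).
  by rewrite !(add_lfunE, lfunD) !addrA.
exact: imaginary_square.
Qed.

Lemma sharp_gensP E F H : sl2_rel E F H -> forall U,
  submodule (sharp_gens E F H) U <-> stable3 (sharpA E F) (sharpB H) (sharpC E F) U.
Proof.
move=> rel U; split=> [sU|[AU BU CU]].
  have st L : L \in sharp_gens E F H -> {homo L : x / x \in U}.
    by move=> /sU LU x xU; apply: (subvP LU); apply: memv_img.
  by split; apply: st; rewrite !inE eqxx ?orbT.
move=> L; rewrite !inE => /or4P[]/eqP->; apply/subvP => _ /memv_imgP[x xU ->]; auto.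
rewrite /sharpDelta !(add_lfunE, opp_lfunE, scale_lfunE, comp_lfunE, id_lfunE).
rewrite (sharp_commutator (sharp_formulasP E F H) rel).
by rewrite memvZ // memvB //; auto.
Qed.

Lemma sharp_diagonal_H E F H : sl2_rel E F H ->
  completely_reducible (sharp_gens E F H) /\
  forall W, irreducible_submodule (sharp_gens E F H) W ->
    LT_basis W (sharpB H) (sharpA E F) (sharpC E F).
Proof.
move=> rel; apply: (chain_module_criterion (sharp_gensP rel)).
exact: chains_span rel (sharp_formulasP E F H).
Qed.

Lemma irreducible_submodule_eq (g1 g2 : seq 'End(V)) W :
  (forall U, submodule g1 U <-> submodule g2 U) ->
  irreducible_submodule g1 W -> irreducible_submodule g2 W.
Proof. by move=> eqg [/eqg sW Wn irr]; split=> // U /eqg; apply: irr. Qed.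

Lemma LT_basis_swap W (L1 L2 L3 : 'End(V)) : LT_basis W L1 L2 L3 -> LT_basis W L1 L3 L2.
Proof. by case=> b [? ? ? ?]; exists b. Qed.

Lemma sharpA_rot E F H : sharpA (rotE E F H) (rotF E F H) = sharpB H.
Proof. by rewrite /sharpA rot_sum. Qed.

Lemma sharpB_rot E F : sharpB (rotH E F) = sharpC E F.
Proof. by []. Qed.

Lemma sharpC_rot E F H : sharpC (rotE E F H) (rotF E F H) = sharpA E F.
Proof. by rewrite /sharpC rot_diff. Qed.

Lemma irreducible_rot E F H W : sl2_rel E F H ->
  irreducible_submodule (sharp_gens E F H) W ->
  irreducible_submodule (sharp_gens (rotE E F H) (rotF E F H) (rotH E F)) W.
Proof.
move=> rel; apply: irreducible_submodule_eq => U.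
rewrite (sharp_gensP rel) (sharp_gensP (rot_sl2 rel)).
by rewrite sharpA_rot sharpB_rot sharpC_rot; split=> -[? ? ?]; split.
Qed.

End Sharp.

Theorem theorem1p7 (R : realType) (V : vectType R[i]) (E F H : 'End(V)) :
  is_sl2_module E F H ->
  completely_reducible (sharp_gens E F H) /\
  (forall W : {vspace V}, irreducible_submodule (sharp_gens E F H) W ->
     leonard_triple_on W (sharpA E F) (sharpB H) (sharpC E F)).
Proof.
move=> /sl2_module_rel rel; have [cred LTB] := sharp_diagonal_H rel.
split=> // W irr; have irr1 := irreducible_rot rel irr.
have rel1 := rot_sl2 rel; have irr2 := irreducible_rot rel1 irr1.
have [_ /(_ W irr1)] := sharp_diagonal_H rel1.
have [_ /(_ W irr2)] := sharp_diagonal_H (rot_sl2 rel1).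
rewrite !(sharpA_rot, sharpC_rot, sharpB_rot) => /LT_basis_swap LTA /LT_basis_swap LTC.
have [sub Wn _] := irr; split; last by split=> //; exact: LTB.
by split=> //; apply: sub; rewrite !inE eqxx ?orbT.
Qed.
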